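(* Let $n\ge 1$. Let $\mathcal{R}_n\subseteq\mathcal{M}_n$ be the family of $n\times n$ complex upper triangular matrices and let $\widehat{\mathcal{R}}_n\subseteq\mathcal{M}_n$ be the family of $n\times n$ upper triangular matrices with constant diagonal (i.e. upper triangular matrices which are the sum of a nilpotent and a scalar matrix). Then $\mathcal{R}_n$ and $\widehat{\mathcal{R}}_n$ form an additive finite free complementary pair, i.e. $\mathcal{R}_n^{\boxplus}=\widehat{\mathcal{R}}_n$ and $\widehat{\mathcal{R}}_n^{\,\boxplus}=\mathcal{R}_n$. Analogously, the family $\mathcal{L}_n$ of $n\times n$ lower triangular matrices and the family $\widehat{\mathcal{L}}_n$ of $n\times n$ lower triangular matrices with constant diagonal form an additive finite free complementary pair.
   Context: $\mathcal{M}_n=\mathbb{C}^{n\times n}$ and $\chi_A(x)=\det(xI-A)$. For polynomials $p(x)=\sum_{k=0}^n a_kx^{n-k}$ and $q(x)=\sum_{k=0}^n b_kx^{n-k}$ of degree $n$ over $\mathbb{C}$, the additive convolution is $p(x)\boxplus q(x)=\sum_{k=0}^n\Big(\sum_{i+j=k}\frac{\binom{n-i}{j}}{\binom{n}{j}}a_ib_j\Big)x^{n-k}$. Matrices $A,B\in\mathcal{M}_n$ are in additive finite free position (additive FFP) if $\chi_{A+B}(x)=\chi_A(x)\boxplus\chi_B(x)$. For $\mathcal{A}\subseteq\mathcal{M}_n$, $\mathcal{A}^{\boxplus}$ is the set of all $B\in\mathcal{M}_n$ that are in additive FFP with every $A\in\mathcal{A}$. Sets $\mathcal{V},\mathcal{W}\subseteq\mathcal{M}_n$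 form an additive finite free complementary pair if $\mathcal{V}^{\boxplus}=\mathcal{W}$ and $\mathcal{W}^{\boxplus}=\mathcal{V}$. *)

(* Defs.v *)
From HB Require Import structures.
From mathcomp Require Import all_boot all_order all_algebra.
From mathcomp Require Import all_classical all_reals.
From mathcomp Require Import complex.

Set Implicit Arguments.
Unset Strict Implicit.
Unset Printing Implicit Defensive.

Import GRing.Theory.
Local Open Scope classical_set_scope.
Local Open Scope ring_scope.

Section FiniteFreePosition.
Variables (C : fieldType) (n : nat).

(* The degree [n] is an explicit parameter of the convolution.  Coefficients
   are indexed from the top: [a_k] is the coefficient of ['X^(n - k)]. *)
Definition additive_convolution (p q : {poly C}) : {poly C} :=
  \sum_(k < n.+1)
     (\sum_(i < n.+1) \sum_(j < n.+1 | (i + j == k)%N)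
         'C(n - i, j)%:R / 'C(n, j)%:R * (p`_(n - i) * q`_(n - j)))
     *: 'X^(n - k).

Definition additive_FFP (A B : 'M[C]_n) : Prop :=
  char_poly (A + B) = additive_convolution (char_poly A) (char_poly B).

Definition FFP_complement (V : set 'M[C]_n) : set 'M[C]_n :=
  [set B | forall A, V A -> additive_FFP A B].

Definition FFP_complementary_pair (V W : set 'M[C]_n) : Prop :=
  FFP_complement V = W /\ FFP_complement W = V.

Definition constant_diagonal (A : 'M[C]_n) : Prop :=
  exists c : C, forall i, A i i = c.

(* [is_trig_mx] is lower triangularity. *)
Definition lower_triangular : set 'M[C]_n := [set A | is_trig_mx A].

Definition upper_triangular : set 'M[C]_n := [set A | is_trig_mx A^T].

Definition lower_triangular_const_diag : set 'M[C]_n :=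
  lower_triangular `&` constant_diagonal.

Definition upper_triangular_const_diag : set 'M[C]_n :=
  upper_triangular `&` constant_diagonal.

End FiniteFreePosition.

(* Main.v *)
Require Import Defs.
From mathcomp Require Import all_boot all_order all_algebra.
From mathcomp Require Import all_classical all_reals.
From mathcomp Require Import complex ring.

(** Write chi_A for the characteristic polynomial of A and M = xI - B.

    The inclusions of each family in the complement of the other hold because
    convolution with (x - c)^n is the translation p(x) |-> p(x - c): the
    binomial coefficients in the definition of the convolution cancel against
    those of (x - c)^n ([additive_convolution_exprXsubC]).  For triangular A
    and triangular B with constant diagonal c, the sum A + B is triangular
    with diagonal entries a_i + c, so chi_(A+B) is exactly this translate of
    chi_A.  Symmetry of the convolution ([additive_convolutionC]) gives the
    other inclusion.

    The reverse inclusions do not need the values of the convolution.  If B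
    lies in the complement of a family, then chi_(A+B) depends only on chi_A
    for A in that family ([FFP_complement_char_poly]).  The matrix units E_ij
    are enough to exploit this, because
    chi_(E_ij + B) = chi_B - cofactor i j M ([char_poly_delta_mxD]).
    - For j < i, E_ij is strictly lower triangular, so it has the same
      characteristic polynomial as 0 and cofactor i j M vanishes.  Hence adj M
      is lower triangular.  Since adj M * M = chi_B I with chi_B nonzero, M,
      and so B, is lower triangular too ([trig_mx_scalar_factor]).
    - All E_ii have the same characteristic polynomial, so the diagonal
      cofactors of M coincide.  The diagonal entries of adj M * M are the
      products (cofactor i i M)(x - b_i) = chi_B, so all b_i coincide.

    The upper triangular case is obtained by transposition, which preserves
    characteristic polynomials. *)

Import GRing.Theory Num.Theory.
Local Open Scope ring_scope.
Local Open Scope complex_scope.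

(** * Binomial expansion in the coefficients of a polynomial *)

Lemma exprXsubC_sum (R : comNzRingType) (c : R) m :
  ('X - c%:P) ^+ m = \sum_(j < m.+1) ('C(m, j)%:R * (- c) ^+ j) *: 'X^(m - j).
Proof.
rewrite -polyCN exprDn; apply: eq_bigr => j _.
by rewrite -mul_polyC polyCM polyCMn polyC1 polyC_exp [in RHS]mulrC mulr_natl mulrnAr.
Qed.

Lemma coef_exprXsubC (R : comNzRingType) (c : R) n j : (j <= n)%N ->
  (('X - c%:P) ^+ n)`_(n - j) = 'C(n, j)%:R * (- c) ^+ j.
Proof.
move=> le_jn; have lt_jn : (j < n.+1)%N by [].
rewrite exprXsubC_sum coef_sum (bigD1 (Ordinal lt_jn)) //=.
rewrite coefZ coefXn eqxx mulr1 big1 ?addr0 // => k ne_kj.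
have /negPf ne_val_kj : val k != j by [].
by rewrite coefZ coefXn eqn_sub2lE -1?ltnS // eq_sym ne_val_kj mulr0.
Qed.

(** The sum is indexed from the top coefficient, over a range that may exceed
    the degree of [p], to match the indexing of the additive convolution. *)
Lemma comp_poly_top_coefs (R : comNzRingType) n (p q : {poly R}) :
  (size p <= n.+1)%N ->
  p \Po q = \sum_(i < n.+1) p`_(n - i) *: q ^+ (n - i).
Proof.
move=> szp.
rewrite comp_polyE (big_ord_widen n.+1 (fun i => p`_i *: q ^+ i)) //.
rewrite big_mkcond (reindex_inj rev_ord_inj) /=.
apply: eq_bigr => i _; rewrite subSS; case: ltnP => // le_p.
by rewrite nth_default ?scale0r.
Qed.

(** * The additive convolution *)

Section Convolution.
Variables (C : fieldType) (n : nat).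
Implicit Types p q : {poly C}.

(** The terms with [n < i + j] that the constraint [i + j = k <= n] excludes
    can be added freely, since their binomial coefficient ['C(n - i, j)]
    vanishes.  The sum is then over a full square, where the roles of [p] and
    [q] can be exchanged. *)
Lemma additive_convolution_double_sum p q :
  additive_convolution n p q =
  \sum_(i < n.+1) \sum_(j < n.+1)
     ('C(n - i, j)%:R / 'C(n, j)%:R * (p`_(n - i) * q`_(n - j)))
       *: 'X^(n - (i + j)).
Proof.
rewrite /additive_convolution.
under eq_bigr => k _.
  rewrite scaler_suml.
  under eq_bigr do rewrite scaler_suml big_mkcond.
  over.
rewrite exchange_big /=; apply: eq_bigr => i _.
rewrite exchange_big /=; apply: eq_bigr => j _.
rewrite -big_mkcond /=.
have [lt_ij|le_n_ij] := ltnP (i + j) n.+1.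
  by apply: (big_pred1 (Ordinal lt_ij)) => k; exact: eq_sym.
rewrite big1 => [|k /eqP def_k].
  by rewrite bin_small ?mul0r ?scale0r // ltn_subLR // -ltnS.
by move: (ltn_ord k); rewrite -def_k ltnNge le_n_ij.
Qed.

Hypothesis char0 : [pchar C] =i pred0.

Let natr_neq0 m : (0 < m)%N -> m%:R != 0 :> C.
Proof.
move=> m_gt0; rewrite natf_neq0_pchar; apply/pnatP => // p _ _.
by rewrite inE /= char0.
Qed.

(** When [i + j <= n] both sides equal
    (n - i)! (n - j)! / (n! (n - i - j)!); otherwise both vanish. *)
Lemma bin_ratio_sym i j : (i <= n)%N -> (j <= n)%N ->
  'C(n - i, j)%:R / 'C(n, j)%:R = 'C(n - j, i)%:R / 'C(n, i)%:R :> C.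
Proof.
move=> le_in le_jn.
apply/eqP; rewrite eqr_div ?natr_neq0 ?bin_gt0 // -!natrM; apply/eqP; congr _%:R.
have [le_ij|lt_n_ij] := leqP (i + j) n; last first.
  by rewrite (@bin_small (n - i)) ?(@bin_small (n - j)) // ltn_subLR // addnC.
have le_j : (j <= n - i)%N by rewrite leq_subRL.
have le_i : (i <= n - j)%N by rewrite leq_subRL // addnC.
have Hi := bin_fact le_in; have Hj := bin_fact le_jn.
rewrite -(bin_fact le_j) in Hi; rewrite -(bin_fact le_i) in Hj.
have sub_sym : (n - i - j = n - j - i)%N by rewrite -!subnDA addnC.
apply/eqP; rewrite -(@eqn_pmul2r (i`! * j`! * (n - i - j)`!)) ?muln_gt0 ?fact_gt0 //.
(* After multiplication by i! j! (n - i - j)!, both products equal n!. *)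
by apply/eqP; transitivity n`!; [rewrite -Hi | rewrite -Hj sub_sym]; ring.
Qed.

Lemma additive_convolutionC p q :
  additive_convolution n p q = additive_convolution n q p.
Proof.
rewrite !additive_convolution_double_sum exchange_big /=.
apply: eq_bigr => i _; apply: eq_bigr => j _.
by rewrite bin_ratio_sym -1?ltnS // [(j + i)%N]addnC [p`__ * _]mulrC.
Qed.

(** The coefficient of ['X^(n - j)] in [('X - c)^n] is ['C(n, j) (- c)^j],
    whose binomial factor cancels the denominator of the convolution.  What is
    left of the sum over [j] is the expansion of [('X - c)^(n - i)]. *)
Lemma additive_convolution_exprXsubC p c : (size p <= n.+1)%N ->
  additive_convolution n p (('X - c%:P) ^+ n) = p \Po ('X - c%:P).
Proof.
move=> szp; rewrite additive_convolution_double_sum (@comp_poly_top_coefs _ n) //.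
apply: eq_bigr => i _; rewrite [in RHS]exprXsubC_sum scaler_sumr.
rewrite [RHS](big_ord_widen n.+1 (fun j =>
  p`_(n - i) *: (('C(n - i, j)%:R * (- c) ^+ j) *: 'X^(n - i - j)))).
  rewrite [RHS]big_mkcond; apply: eq_bigr => j _; case: ltnP => [_|lt_j].
    rewrite coef_exprXsubC -1?ltnS // scalerA subnDA mulrA; congr (_ *: _).
    have bin_neq0 : 'C(n, j)%:R != 0 :> C by rewrite natr_neq0 ?bin_gt0 -1?ltnS.
    rewrite mulrA [RHS]mulrA; congr (_ * _).
    by rewrite mulrAC divfK // mulrC.
  by rewrite bin_small ?mul0r ?scale0r.
by rewrite ltnS leq_subr.
Qed.

Lemma additive_FFP_trmx (A B : 'M[C]_n) :
  additive_FFP A^T B^T <-> additive_FFP A B.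
Proof.
have char_tr (M : 'M[C]_n) : char_poly M^T = char_poly M.
  rewrite /char_poly -[RHS]det_tr; congr (\det _).
  by rewrite /char_poly_mx raddfB /= tr_scalar_mx map_trmx.
by rewrite /additive_FFP -raddfD !char_tr.
Qed.

Lemma additive_FFPC (A B : 'M[C]_n) : additive_FFP A B -> additive_FFP B A.
Proof. by rewrite /additive_FFP addrC additive_convolutionC. Qed.

Lemma additive_FFP_trig_const_diag (A B : 'M[C]_n) :
  is_trig_mx A -> is_trig_mx B -> constant_diagonal B -> additive_FFP A B.
Proof.
move=> trigA trigB [c diagB].
have trigAB : is_trig_mx (A + B).
  apply/is_trig_mxP => i j lt_ij.
  by rewrite mxE (is_trig_mxP trigA) // (is_trig_mxP trigB) // addr0.
have chiB : char_poly B = ('X - c%:P) ^+ n.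
  rewrite char_poly_trig //; under eq_bigr do rewrite diagB.
  by rewrite prodr_const card_ord.
rewrite /additive_FFP chiB additive_convolution_exprXsubC ?size_char_poly //.
rewrite !char_poly_trig // rmorph_prod; apply: eq_bigr => i _.
by rewrite /= rmorphB /= comp_polyX comp_polyC mxE diagB polyCD opprD addrA addrAC.
Qed.

End Convolution.

(** * Matrix units, cofactors and triangular factors *)

Lemma det_sub_delta_mx (R : comPzRingType) n (A : 'M[R]_n) i j :
  \det (A - delta_mx i j) = \det A - cofactor A i j.
Proof.
have eq_cof k : cofactor (A - delta_mx i j) i k = cofactor A i k.
  rewrite /cofactor; congr (_ * \det _); apply/matrixP => r s.
  by rewrite !mxE eq_sym (negPf (neq_lift _ _)) subr0.
rewrite !(expand_det_row _ i) (bigD1 j) //= [in RHS](bigD1 j) //= eq_cof !mxE !eqxx.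
rewrite mulrBl mul1r addrAC; congr (_ + _ - _); apply: eq_bigr => k ne_kj.
by rewrite eq_cof !mxE (negPf ne_kj) andbF subr0.
Qed.

Lemma char_poly_delta_mxD (R : comNzRingType) n (A : 'M[R]_n) i j :
  char_poly (delta_mx i j + A) = char_poly A - cofactor (char_poly_mx A) i j.
Proof.
rewrite -det_sub_delta_mx /char_poly; congr (\det _).
by rewrite /char_poly_mx raddfD /= map_delta_mx opprD addrCA addrC.
Qed.

Lemma delta_mx_is_trig (R : pzRingType) n (i j : 'I_n) : (j <= i)%N ->
  is_trig_mx (delta_mx i j : 'M[R]_n).
Proof.
move=> le_ji; apply/is_trig_mxP => k l lt_kl; rewrite mxE.
case: eqP lt_kl => // ->; case: eqP => // -> lt_ij.
by rewrite ltnNge le_ji in lt_ij.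
Qed.

(** Over the fraction field, [M] is [d] times the inverse of the triangular
    matrix [L].  Forward substitution gives the result without inverting: the
    diagonal of [L] has no zero because [\det L * \det M = d ^+ n], and the
    rows of [M] are then treated in increasing order. *)
Lemma trig_mx_scalar_factor (R : idomainType) n (L M : 'M[R]_n) d :
  d != 0 -> is_trig_mx L -> L *m M = d%:M ->
  is_trig_mx M /\ forall i, L i i * M i i = d.
Proof.
move=> d_neq0 trigL LM.
have L_neq0 i : L i i != 0.
  have : \det L * \det M != 0 by rewrite -det_mulmx LM det_scalar expf_neq0.
  rewrite mulf_eq0 negb_or det_trig // => /andP[+ _].
  by move/prodf_neq0; apply.
have trigM (j k : 'I_n) : (j < k)%N -> M j k = 0.
  have [m] := ubnP j; elim: m j => // m IHm j le_jm lt_jk.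
  have /eqP := congr1 (fun N : 'M_n => N j k) LM.
  (* In entry (j, k) of L *m M, the terms l < j vanish by induction and the
     terms l > j by triangularity of L, which leaves L j j * M j k = 0. *)
  rewrite !mxE -[_ == k]val_eqE (ltn_eqF lt_jk) (bigD1 j) //= big1 ?addr0.
    by rewrite mulf_eq0 (negPf (L_neq0 j)) => /eqP.
  move=> l; rewrite -val_eqE; case: ltngtP => // [lt_lj|lt_jl] _.
    by rewrite (IHm l (leq_trans lt_lj le_jm) (ltn_trans lt_lj lt_jk)) mulr0.
  by rewrite (is_trig_mxP trigL) ?mul0r.
split=> [|i]; first exact/is_trig_mxP.
have := congr1 (fun N : 'M_n => N i i) LM.
rewrite !mxE eqxx (bigD1 i) //= big1 ?addr0 // => l.
rewrite -val_eqE; case: ltngtP => // [lt_li|lt_il] _.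
  by rewrite trigM ?mulr0.
by rewrite (is_trig_mxP trigL) ?mul0r.
Qed.

(** * Complements of the triangular families *)

Section Complement.
Variables (C : fieldType) (n : nat).
Implicit Types A B : 'M[C]_n.

(** All that the reverse inclusions use about free position: the convolution
    sees [A] only through its characteristic polynomial. *)
Lemma FFP_complement_char_poly (V : set 'M[C]_n) A A' B :
  FFP_complement V B -> V A -> V A' -> char_poly A = char_poly A' ->
  char_poly (A + B) = char_poly (A' + B).
Proof. by move=> VB VA VA' eqA; rewrite VB // VB // eqA. Qed.

Lemma FFP_complement_anti (V W : set 'M[C]_n) :
  (V `<=` W)%classic -> (FFP_complement W `<=` FFP_complement V)%classic.
Proof. by move=> sVW B WB A /sVW /WB. Qed.

Lemma char_poly_delta_mx_strict (i j : 'I_n) : (j < i)%N ->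
  char_poly (delta_mx i j) = char_poly (0 : 'M[C]_n).
Proof.
move=> lt_ji; rewrite !char_poly_trig ?mx0_is_trig ?delta_mx_is_trig ?(ltnW lt_ji) //.
apply: eq_bigr => k _; rewrite !mxE.
by case: eqP => // ->; rewrite -val_eqE (gtn_eqF lt_ji).
Qed.

(** The right-hand side does not depend on [i], so the convolution cannot tell
    the diagonal matrix units apart. *)
Lemma char_poly_delta_mx_diag (i : 'I_n) :
  char_poly (delta_mx i i : 'M[C]_n) = ('X - 1) * 'X ^+ n.-1.
Proof.
rewrite char_poly_trig ?delta_mx_is_trig // (bigD1 i) //= mxE !eqxx; congr (_ * _).
rewrite -[n in n.-1]card_ord -(cardC1 i) -prodr_const.
by apply: eq_bigr => k /negPf ne_ki; rewrite mxE ne_ki subr0.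
Qed.

(** The triangular factor lemma for [\adj M *m M = (\det M)%:M] with
    [M = char_poly_mx B], where [\det M] is monic, hence nonzero. *)
Lemma char_poly_mx_scalar_factor B :
  is_trig_mx (\adj (char_poly_mx B)) ->
  is_trig_mx B /\
  forall i, cofactor (char_poly_mx B) i i * ('X - (B i i)%:P) = char_poly B.
Proof.
move=> trig_adj.
have chi_neq0 : char_poly B != 0 by rewrite monic_neq0 ?char_poly_monic.
have [trigM diagM] := trig_mx_scalar_factor _ _ _ _ _ chi_neq0 trig_adj (mul_adj_mx _).
split=> [|i]; last by have := diagM i; rewrite !mxE eqxx.
apply/is_trig_mxP => i j lt_ij; have := is_trig_mxP trigM i j lt_ij.
rewrite !mxE -val_eqE (ltn_eqF lt_ij) mulr0n sub0r => /eqP.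
by rewrite oppr_eq0 polyC_eq0 => /eqP.
Qed.

Lemma delta_mx_lower_const_diag (i j : 'I_n) : (j < i)%N ->
  @lower_triangular_const_diag C n (delta_mx i j).
Proof.
move=> lt_ji; split; first by rewrite /lower_triangular /= delta_mx_is_trig // ltnW.
exists 0 => k; rewrite mxE.
by case: eqP => // ->; rewrite -val_eqE (gtn_eqF lt_ji).
Qed.

(** Below the diagonal, [E_ij] and [0] have the same characteristic
    polynomial, so adding [E_ij] to [B] leaves that of [B] unchanged, and the
    cofactor that measures the change is zero.  The adjugate transposes
    indices: these cofactors are its entries above the diagonal. *)
Lemma trig_adj_of_FFP_complement B :
  FFP_complement (@lower_triangular_const_diag C n) B ->
  is_trig_mx (\adj (char_poly_mx B)).
Proof.
move=> cB; apply/is_trig_mxP => j i lt_ji; rewrite mxE.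
have zero_lcd : @lower_triangular_const_diag C n 0.
  by split; [exact: mx0_is_trig | exists 0 => k; rewrite mxE].
have := FFP_complement_char_poly _ _ _ _ cB (delta_mx_lower_const_diag _ _ lt_ji)
  zero_lcd (char_poly_delta_mx_strict _ _ lt_ji).
rewrite add0r char_poly_delta_mxD => /eqP.
by rewrite -subr_eq0 addrAC subrr sub0r oppr_eq0 => /eqP.
Qed.

Lemma lower_const_diag_sub_lower :
  (@lower_triangular_const_diag C n `<=` @lower_triangular C n)%classic.
Proof. by move=> A []. Qed.

(** The diagonal matrix units are available here because the test family
    contains all lower triangular matrices; they make the diagonal cofactors
    [r] of [xI - B] equal, and [r * ('X - b_i) = char_poly B] then determines
    [b_i]. *)
Lemma const_diag_of_FFP_complement B :
  FFP_complement (@lower_triangular C n) B -> constant_diagonal B.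
Proof.
move=> cB.
have /char_poly_mx_scalar_factor[_ diagB] :=
  trig_adj_of_FFP_complement _ (FFP_complement_anti _ _ lower_const_diag_sub_lower _ cB).
have eq_cof i j : cofactor (char_poly_mx B) i i = cofactor (char_poly_mx B) j j.
  apply/oppr_inj/(addrI (char_poly B)); rewrite -!char_poly_delta_mxD.
  apply: FFP_complement_char_poly cB _ _ _; rewrite ?char_poly_delta_mx_diag //.
  - exact: delta_mx_is_trig.
  - exact: delta_mx_is_trig.
have eq_diag i j : B i i = B j j.
  have chi_neq0 : char_poly B != 0 by rewrite monic_neq0 ?char_poly_monic.
  have cof_neq0 : cofactor (char_poly_mx B) i i != 0.
    by apply: contraNneq chi_neq0 => cof0; rewrite -(diagB i) cof0 mul0r.
  have := diagB j; rewrite -(diagB i) (eq_cof j i) => /(mulfI cof_neq0).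
  by move/addrI/oppr_inj/polyC_inj.
have [i0 _|no_index] := pickP (fun _ : 'I_n => true).
  by exists (B i0 i0) => i; exact: eq_diag.
by exists 0 => i; have := no_index i.
Qed.

Theorem lower_triangular_complementary_pair : [pchar C] =i pred0 ->
  FFP_complementary_pair (@lower_triangular C n) (@lower_triangular_const_diag C n).
Proof.
move=> char0; split; apply/seteqP; split=> B.
- move=> cB; split; last exact: const_diag_of_FFP_complement.
  have cB' := FFP_complement_anti _ _ lower_const_diag_sub_lower _ cB.
  by have [] := char_poly_mx_scalar_factor _ (trig_adj_of_FFP_complement _ cB').
- by move=> [trigB diagB] A trigA; exact: additive_FFP_trig_const_diag.
- by move=> /trig_adj_of_FFP_complement/char_poly_mx_scalar_factor[].
- move=> trigB A [trigA diagA]; apply: additive_FFPC => //.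
  exact: additive_FFP_trig_const_diag.
Qed.

Lemma FFP_complement_trmx (V : set 'M[C]_n) :
  FFP_complement [set A | V A^T]%classic = [set B | FFP_complement V B^T]%classic.
Proof.
apply/seteqP; split=> B cB A VA.
  rewrite -[A]trmxK; apply/(additive_FFP_trmx _ _ A^T B).
  by apply: cB; rewrite /= trmxK.
by apply/(additive_FFP_trmx _ _ A B); apply: cB.
Qed.

Lemma FFP_complementary_pair_trmx (V W : set 'M[C]_n) :
  FFP_complementary_pair V W ->
  FFP_complementary_pair [set A | V A^T]%classic [set A | W A^T]%classic.
Proof. by move=> [cV cW]; split; rewrite FFP_complement_trmx ?cV ?cW. Qed.

End Complement.

Theorem theorem4p10 (R : realType) (n : nat) (n_ge1 : (1 <= n)%N) :
  FFP_complementary_pair (@upper_triangular R[i] n)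
                         (@upper_triangular_const_diag R[i] n) /\
  FFP_complementary_pair (@lower_triangular R[i] n)
                         (@lower_triangular_const_diag R[i] n).
Proof.
have lower_pair := lower_triangular_complementary_pair R[i] n (pchar_num _).
split=> //.
have -> : @upper_triangular_const_diag R[i] n =
    [set A | @lower_triangular_const_diag R[i] n A^T]%classic.
  apply/seteqP; split=> A [upperA [c diagA]]; split=> //; exists c => i.
    by rewrite mxE.
  by rewrite -(diagA i) mxE.
exact: FFP_complementary_pair_trmx lower_pair.
Qed.
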